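(* The ring $\mathrm{QSym}$ of quasisymmetric functions over $\mathbb{Z}$ (in countably many variables $x_1,x_2,\dots$) is free as a module over its subring $\mathrm{Sym}$ of symmetric functions over $\mathbb{Z}$.
   Context: $\mathrm{QSym}$ is the subring of $\mathbb{Z}[[x_1,x_2,\dots]]$ spanned over $\mathbb{Z}$ by the monomial quasisymmetric functions $M_\alpha=\sum_{i_1<\dots<i_r}x_{i_1}^{\alpha_1}\cdots x_{i_r}^{\alpha_r}$, where $\alpha=(\alpha_1,\dots,\alpha_r)$ ranges over all compositions (finite sequences of positive integers, including the empty one, $M_\varnothing=1$). $\mathrm{Sym}\subseteq\mathrm{QSym}$ is the subring of symmetric functions, spanned by the monomial symmetric functions $m_\lambda=\sum_{\alpha}M_\alpha$, the sum over the distinct compositions $\alpha$ that sort to the partition $\lambda$. *)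

(* Defs.v *)
From HB Require Import structures.
From mathcomp Require Import all_boot all_order all_algebra finmap.
From mathcomp.multinomials Require Import monalg.
From mathcomp.classical Require Import boolp classical_sets functions.
From mathcomp.classical Require Import cardinality fsbigop.

Set Implicit Arguments.
Unset Strict Implicit.
Unset Printing Implicit Defensive.

Import GRing.Theory.

Local Open Scope classical_set_scope.
Local Open Scope ring_scope.

Definition lincomb (R : nzRingType) (V : lmodType R) (I : choiceType)
    (b : I -> V) (c : {fsfun I -> R with 0}) : V :=
  \sum_(i <- finsupp c) c i *: b i.

Definition is_basis (R : nzRingType) (V : lmodType R) (I : choiceType)
    (b : I -> V) : Prop :=
  (forall v : V, exists c : {fsfun I -> R with 0}, v = lincomb b c) /\
  (forall c : {fsfun I -> R with 0},
     lincomb b c = 0 -> forall i : I, c i = 0).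

Definition free_module (R : nzRingType) (V : lmodType R) : Prop :=
  exists (I : choiceType) (b : I -> V), is_basis b.

Arguments free_module R V : clear implicits.

Definition zspan (V : zmodType) (I : Type) (g : I -> V) : {pred V} :=
  mem [set v | exists s : seq (int * I), v = \sum_(p <- s) g p.2 *~ p.1].

(* Z[[x_0, x_1, ...]]: a power series is the family of its coefficients,     *)
(* indexed by the monomials in countably many variables.                     *)
Definition pseries : Type := {cmonom nat} -> int.

HB.instance Definition _ := GRing.Zmodule.copy pseries ({cmonom nat} -> int).

Definition psmono (u : {cmonom nat}) : pseries := fun m => (m == u)%:R.

Definition psvar (i : nat) : pseries := psmono (ucm i).

(* The sum is finite, as a monomial has finitely many factorizations.        *)
Definition psmul (f g : pseries) : pseries :=
  fun m => \sum_(p \in [set p | mmul p.1 p.2 = m]) f p.1 * g p.2.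

Section PowerSeriesRing.
Implicit Types (f g h : pseries) (m u v : {cmonom nat}).

Lemma psD f g m : (f + g) m = f m + g m. Proof. by []. Qed.
Lemma psN f m : (- f) m = - f m. Proof. by []. Qed.
Lemma ps0 m : (0 : pseries) m = 0. Proof. by []. Qed.

Lemma psMz f (z : int) m : (f *~ z) m = f m *~ z.
Proof.
have Mn (n : nat) : (f *+ n) m = f m *+ n.
  by elim: n => [|n IH]; rewrite ?mulr0n // !mulrS psD IH.
by case: z => n; rewrite ?NegzE ?mulrNz ?psN -?pmulrn Mn.
Qed.

Lemma pssum (I : Type) (r : seq I) (P : pred I) (F : I -> pseries) m :
  (\sum_(i <- r | P i) F i) m = \sum_(i <- r | P i) F i m.
Proof. by elim/big_rec2: _ => // i x y _ <-. Qed.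

Lemma psmulE (r : {fset {cmonom nat}}) f g m :
    (forall u v, mmul u v = m -> f u * g v != 0 -> (u \in r) && (v \in r)) ->
  psmul f g m = \sum_(u <- r) \sum_(v <- r) (f u * g v) *+ (mmul u v == m).
Proof.
move=> rP; rewrite /psmul fsbig_mkcond.
pose F p : int := patch (fun=> 0) [set p | mmul p.1 p.2 = m]
                    (fun p => f p.1 * g p.2) p.
have FE u v : F (u, v) = (f u * g v) *+ (mmul u v == m).
  rewrite /F /patch; case: ifPn; first by rewrite inE /= => ->; rewrite eqxx.
  by rewrite notin_setE /= => /eqP/negPf ->.
have -> : [set: ({cmonom nat} * {cmonom nat})] = [set` predT].
  by apply/seteqP; split.
rewrite -(@bigfs _ _ _ _ [seq (u, v) | u <- r, v <- r] predT F) //.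
- rewrite big_allpairs; apply: eq_bigr => u _; apply: eq_bigr => v _.
  exact: FE.
- by apply: allpairs_uniq; rewrite ?fset_uniq // => -[u v] [u' v'].
move=> [u v] _ nr; rewrite FE; case: eqP => [uvm|]; last by rewrite mulr0n.
apply/eqP; apply: contraNT nr => /(rP _ _ uvm) /andP[ur vr].
by apply/allpairsP; exists (u, v).
Qed.

Lemma eq_psmul f f' g g' m :
    (forall u v, mmul u v = m -> f u = f' u /\ g v = g' v) ->
  psmul f g m = psmul f' g' m.
Proof.
by move=> E; apply: eq_fsbigr => -[u v]; rewrite inE /= => /E [-> ->].
Qed.

Lemma psmul_malg (x y : {malg int[{cmonom nat}]}) :
  psmul (fun u => mcoeff u x) (fun u => mcoeff u y) =
  (fun u => mcoeff u (x * y)).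
Proof.
apply/funext => m.
rewrite (@mcoeffMlw _ _ (msupp x `|` msupp y) (msupp x `|` msupp y))%fset;
  [|exact: fsubsetUl|exact: fsubsetUr].
apply: psmulE => u v _; rewrite mulf_eq0 negb_or !mcoeff_neq0 !in_fsetU.
by case/andP => -> ->; rewrite orbT.
Qed.

Definition cmdvd_of m (g : {ffun finsupp m -> 'I_(mdeg m).+1}) : {cmonom nat} :=
  [cmonom val (g i) | i : finsupp m]%M.

Definition cmdvd_enum m : {fset {cmonom nat}} :=
  [fset u in codom (@cmdvd_of m)]%fset.

Lemma cmdvd_enumP u v : u \in cmdvd_enum (mmul u v).
Proof.
set m := mmul u v.
have le i : (u i <= m i)%N by rewrite cmM leq_addr.
have lt (i : finsupp m) : (u (val i) < (mdeg m).+1)%N.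
  rewrite ltnS (leq_trans (le _)) // mdegE (big_fsetD1 (val i)) ?leq_addr //.
  exact: valP.
rewrite inE; apply/codomP; exists [ffun i => Ordinal (lt i)].
apply/eqP/cmP => i; rewrite cmE fsfun_ffun.
case: insubP => [j _ <-|/=]; first by rewrite /= ffunE.
by rewrite -cmE_eq0 => /eqP mi0; have := le i; rewrite mi0 leqn0 => /eqP.
Qed.

Definition pstrunc (s : {fset {cmonom nat}}) f : {malg int[{cmonom nat}]} :=
  [malg u in s => f u].

Lemma pstruncE s f u : u \in s -> mcoeff u (pstrunc s f) = f u.
Proof. by move=> us; rewrite mcoeffE us. Qed.

Lemma psmulC : commutative psmul.
Proof.
move=> f g; apply/funext => m.
pose T := pstrunc (cmdvd_enum m).
have E f' u v : mmul u v = m -> f' u = mcoeff u (T f').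
  by move=> uv; rewrite /T pstruncE // -uv cmdvd_enumP.
have EC f' u v : mmul u v = m -> f' v = mcoeff v (T f').
  by rewrite mulmC => /E.
rewrite (@eq_psmul f (fun u => mcoeff u (T f)) g (fun u => mcoeff u (T g)));
  last by move=> u v uv; split; [exact: E uv | exact: EC uv].
rewrite (@eq_psmul g (fun u => mcoeff u (T g)) f (fun u => mcoeff u (T f)));
  last by move=> u v uv; split; [exact: E uv | exact: EC uv].
by rewrite !psmul_malg mulrC.
Qed.

Lemma psmulA : associative psmul.
Proof.
move=> f g h; apply/funext => m.
pose T f' : pseries := fun u => mcoeff u (pstrunc (cmdvd_enum m) f').
have E f' u v : mmul u v = m -> f' u = T f' u.
  by move=> uv; rewrite /T pstruncE // -uv cmdvd_enumP.
have EC f' u v : mmul u v = m -> f' v = T f' v.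
  by rewrite mulmC => /E.
have EM f' g' u v : mmul u v = m -> psmul f' g' u = psmul (T f') (T g') u.
  move=> uv; apply: eq_psmul => a b ab; split.
    by apply: (E _ _ (mmul b v)); rewrite mulmA ab.
  by apply: (E _ _ (mmul a v)); rewrite mulmA (mulmC b) ab.
rewrite (@eq_psmul f (T f) (psmul g h) (psmul (T g) (T h))); last first.
  move=> u v uv; split; first exact: E uv.
  by apply: (EM _ _ _ u); rewrite mulmC.
rewrite (@eq_psmul (psmul f g) (psmul (T f) (T g)) h (T h)); last first.
  by move=> u v uv; split; [exact: EM uv | exact: EC uv].
by rewrite !psmul_malg mulrA.
Qed.

Lemma psmono_malg u :
  psmono u = fun m => mcoeff m (<< u >> : {malg int[{cmonom nat}]}).
Proof. by apply/funext => m; rewrite mcoeffU1 eq_sym. Qed.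

Lemma psmul_mono u v : psmul (psmono u) (psmono v) = psmono (mmul u v).
Proof.
rewrite !psmono_malg psmul_malg; apply/funext => m.
by rewrite malgM_def fgmulUU mulr1.
Qed.

Lemma psmul1 : left_id (psmono mone) psmul.
Proof.
move=> f; apply/funext => m.
pose T f' : pseries := fun u => mcoeff u (pstrunc (cmdvd_enum m) f').
rewrite (@eq_psmul (psmono mone) (psmono mone) f (T f)); last first.
  by move=> u v uv; split=> //; rewrite /T pstruncE // -uv mulmC cmdvd_enumP.
have -> : psmono mone = fun u => mcoeff u (1 : {malg int[{cmonom nat}]}).
  by apply/funext => u; rewrite mcoeff1.
rewrite psmul_malg mul1r pstruncE //.
by have := cmdvd_enumP m mone; rewrite mulm1.
Qed.

Lemma psmulDl : left_distributive psmul +%R.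
Proof.
move=> f g h; apply/funext => m; rewrite psD.
have H k : forall u v, mmul u v = m -> k u * h v != 0 ->
    (u \in cmdvd_enum m) && (v \in cmdvd_enum m).
  by move=> u v <- _; rewrite cmdvd_enumP mulmC cmdvd_enumP.
rewrite !(psmulE (H _)) -big_split; apply: eq_bigr => u _.
by rewrite /= -big_split; apply: eq_bigr => v _; rewrite /= -mulrnDl -mulrDl.
Qed.

Lemma ps1_neq0 : psmono mone != 0.
Proof.
by apply/eqP => /(congr1 (@^~ mone)); rewrite /psmono eqxx.
Qed.

End PowerSeriesRing.

HB.instance Definition _ := GRing.Zmodule_isComNzRing.Build pseries
  psmulA psmulC psmul1 psmulDl ps1_neq0.

Definition composition : Type := {a : seq nat | 0%N \notin a}.

Definition integer_partition : Type :=
  {l : seq nat | (0%N \notin l) && sorted geq l}.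

(* The sum of the monomials x_{i_1}^{a_1} ... x_{i_r}^{a_r} over             *)
(* i_1 < ... < i_r, taken coefficient by coefficient.                        *)
Definition monomial_qsym (a : seq nat) : pseries :=
  fun m => \sum_(i \in [set i : (size a).-tuple nat | sorted ltn i])
             (\prod_(k < size a) psvar (tnth i k) ^+ nth 0%N a k) m.

(* permutations l lists the distinct rearrangements of l, each once.         *)
Definition monomial_sym (l : seq nat) : pseries :=
  \sum_(a <- permutations l) monomial_qsym a.

Definition qsym_pred : {pred pseries} :=
  zspan (fun a : composition => monomial_qsym (val a)).

Definition sym_pred : {pred pseries} :=
  zspan (fun l : integer_partition => monomial_sym (val l)).

Section QSymClosed.
Implicit Types (f g : pseries) (m u v : {cmonom nat}) (a s w : seq nat).

Definition exps m : seq nat := [seq m i | i <- sort leq (finsupp m)].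

Lemma sorted_finsupp m : sorted ltn (sort leq (finsupp m)).
Proof.
by rewrite ltn_sorted_uniq_leq sort_uniq fset_uniq sort_sorted //; exact: leq_total.
Qed.

Lemma exps_sub s m : sorted ltn s -> (forall i, m i != 0%N -> i \in s) ->
  exps m = [seq x <- map m s | x != 0%N].
Proof.
move=> ss ms; rewrite filter_map /exps; congr map.
apply: (irr_sorted_eq ltn_trans ltnn (sorted_finsupp m)).
  exact: (sorted_filter ltn_trans).
by move=> i; rewrite mem_sort mem_filter /= -cmE_neq0 andb_idr //; exact: ms.
Qed.

Lemma exps_perm s m : uniq s -> (forall i, m i != 0%N -> i \in s) ->
  perm_eq (exps m) [seq x <- map m s | x != 0%N].
Proof.
move=> us ms; rewrite filter_map /exps; apply: perm_map.
apply: uniq_perm; rewrite ?filter_uniq ?sort_uniq ?fset_uniq //.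
by move=> i; rewrite mem_sort mem_filter /= -cmE_neq0 andb_idr //; exact: ms.
Qed.

Lemma exps_neq0 m : 0%N \notin exps m.
Proof.
apply/mapP => -[i]; rewrite mem_sort -cmE_neq0 => /[swap] <-.
by rewrite eqxx.
Qed.

Lemma mdeg_exps m : mdeg m = sumn (exps m).
Proof.
rewrite mdegE sumnE big_map; apply: perm_big.
by rewrite perm_sym perm_sort.
Qed.

Definition cmon_of s w : {cmonom nat} :=
  [cmonom nth 0%N w (index i s) | i in [fset i in s]%fset]%M.

Lemma cmon_ofE s w i : size w = size s -> cmon_of s w i = nth 0%N w (index i s).
Proof.
move=> sw; rewrite cmE fsfun_fun inE; case: ifPn => // /negP/negP si.
by rewrite nth_default // sw leqNgt index_mem.
Qed.

Lemma cmon_of_supp s w i : size w = size s -> cmon_of s w i != 0%N -> i \in s.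
Proof.
move=> sw; rewrite cmon_ofE //; apply: contraNT => si.
by rewrite nth_default // sw leqNgt index_mem.
Qed.

Lemma map_cmon_of s w : uniq s -> size w = size s -> map (cmon_of s w) s = w.
Proof.
move=> us sw; apply: (@eq_from_nth _ 0%N); first by rewrite size_map.
move=> i; rewrite size_map => si.
by rewrite (nth_map 0%N) // cmon_ofE // index_uniq.
Qed.

Lemma cmon_ofK s m : uniq s -> (forall i, m i != 0%N -> i \in s) ->
  cmon_of s (map m s) = m.
Proof.
move=> us ms; apply/eqP/cmP => i; rewrite cmon_ofE ?size_map //.
have [si|si] := boolP (i \in s).
  by rewrite (nth_map 0%N) ?index_mem // nth_index.
rewrite nth_default ?size_map 1?leqNgt ?index_mem //.
by apply/esym/eqP; apply: contraNT si; exact: ms.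
Qed.

Lemma psmonoM u v : psmono u * psmono v = psmono (mmul u v).
Proof. exact: psmul_mono. Qed.

Lemma monomialE s a : uniq s -> size a = size s ->
  \prod_(k < size a) psvar (nth 0%N s k) ^+ nth 0%N a k = psmono (cmon_of s a).
Proof.
move=> us sa.
have X u n : psmono u ^+ n = psmono (iter n (mmul u) mone).
  by elim: n => // n IH; rewrite exprS IH psmonoM.
have XE u n j : (iter n (mmul u) mone : {cmonom nat}) j = (n * u j)%N.
  by elim: n => [|n IH] /=; rewrite ?cm1 // cmM IH mulSn.
under eq_bigr do rewrite X.
have M1 : {morph psmono : u v / mmul u v >-> u * v}.
  by move=> u v; rewrite psmonoM.
rewrite -(big_morph psmono M1 (erefl : psmono mone = 1)).
congr psmono; apply/eqP/cmP => j.
have M2 : {morph (fun u : {cmonom nat} => u j) : u v / mmul u v >-> (u + v)%N}.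
  by move=> u v; rewrite cmM.
rewrite (big_morph _ M2 (cm1 j)).
under eq_bigr do rewrite XE cmU.
rewrite cmon_ofE //; have [js|js] := boolP (j \in s); last first.
  rewrite nth_default ?sa 1?leqNgt ?index_mem // big1 // => k _.
  case: eqP => [jk|]; last by rewrite muln0.
  by rewrite -jk mem_nth // -sa in js.
have lt : (index j s < size a)%N by rewrite sa index_mem.
rewrite (bigD1 (Ordinal lt)) //= nth_index // eqxx muln1 big1 ?addn0 // => k nk.
case: eqP => [jk|]; last by rewrite muln0.
by move: nk; rewrite -val_eqE /= -jk index_uniq ?eqxx // -sa.
Qed.

Lemma monomial_qsymE a m : 0%N \notin a ->
  monomial_qsym a m = (exps m == a)%:R.
Proof.
move=> a0.
have E (i : (size a).-tuple nat) : sorted ltn i ->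
    (\prod_(k < size a) psvar (tnth i k) ^+ nth 0%N a k) m =
    (m == cmon_of i a)%:R.
  move=> si; have ui : uniq i by move: si; rewrite ltn_sorted_uniq_leq => /andP[].
  under eq_bigr do rewrite (tnth_nth 0%N).
  by rewrite monomialE ?size_tuple.
have F (i : (size a).-tuple nat) : sorted ltn i -> exps (cmon_of i a) = a.
  move=> si; have ui : uniq i by move: si; rewrite ltn_sorted_uniq_leq => /andP[].
  rewrite (exps_sub si); last by move=> j; apply: cmon_of_supp; rewrite size_tuple.
  rewrite map_cmon_of ?size_tuple //; apply/all_filterP/allP => x xa.
  by apply: contraNneq a0 => <-.
have [ma|ma] := eqVneq (exps m) a; last first.
  rewrite /monomial_qsym fsbig1 // => i /= si; rewrite E //.
  by case: eqP => // mi; move: ma; rewrite mi F // eqxx.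
have sz : size (sort leq (finsupp m)) == size a by rewrite -ma size_map.
have um : uniq (sort leq (finsupp m)) by rewrite sort_uniq fset_uniq.
have sm := sorted_finsupp m.
have mE : cmon_of (sort leq (finsupp m)) a = m.
  by rewrite -ma cmon_ofK // => i; rewrite mem_sort cmE_neq0.
rewrite /monomial_qsym -(@fsbig_widen _ _ _ _ [set Tuple sz]).
- by rewrite fsbig_set1 E //= mE eqxx.
- by move=> i /= ->.
move=> i /= [si ni]; rewrite E //; case: eqP => // mi; case: ni.
apply: val_inj => /=; apply: (irr_sorted_eq ltn_trans ltnn) => // j.
have si2 : size a = size (val i) by rewrite size_tuple.
rewrite mem_sort -cmE_neq0 mi cmon_ofE //.
have [ji|ji] := boolP (j \in val i).
  by apply/esym; apply: contraNneq a0 => <-; rewrite mem_nth // [X in (_ < X)%N]si2 index_mem.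
by rewrite nth_default ?eqxx // [X in (X <= _)%N]si2 leqNgt index_mem.
Qed.

(* Both spans consist of the power series of bounded degree whose            *)
(* coefficients depend only on the exponents: in order for QSym, up to       *)
(* permutation for Sym.                                                      *)
Definition bounded_deg f := exists N, forall m, (N < mdeg m)%N -> f m = 0.

Lemma zspanP (V : zmodType) (I : Type) (h : I -> V) x :
  x \in zspan h <-> exists s : seq (int * I), x = \sum_(p <- s) h p.2 *~ p.1.
Proof. by rewrite /zspan inE. Qed.

Lemma zspan_zmod (V : zmodType) (I : Type) (h : I -> V) :
  zmod_closed (zspan h).
Proof.
split; first by apply/zspanP; exists [::]; rewrite big_nil.
move=> x y /zspanP[r ->] /zspanP[t ->]; apply/zspanP.
exists (r ++ [seq (- p.1, p.2) | p <- t]); rewrite big_cat big_map /=.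
congr (_ + _); rewrite -sumrN; apply: eq_bigr => p _ /=.
by rewrite mulrNz.
Qed.

Lemma exists_bounded N (P : pred (seq nat)) : (forall a, P a -> 0%N \notin a) ->
  exists L : seq (sig P), uniq L /\
    forall a : sig P, (sumn (val a) <= N)%N -> a \in L.
Proof.
move=> P0.
pose L1 := [seq [seq val x | x : 'I_N.+1 <- val t & val x != 0%N]
             | t : N.-tuple 'I_N.+1].
exists (undup (pmap insub L1)); split; first exact: undup_uniq.
move=> [a Pa] /= sa; rewrite mem_undup mem_pmap_sub /=.
have a0 := P0 a Pa.
have szN : (size a <= N)%N.
  apply: leq_trans sa; elim: a a0 {Pa} => //= x a IH.
  by rewrite inE negb_or => /andP[x0 /IH le]; rewrite -add1n leq_add // lt0n eq_sym.
have aN x : x \in a -> (x < N.+1)%N.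
  move=> xa; rewrite ltnS; apply: leq_trans sa; elim: (a) xa => //= y b IH.
  by rewrite inE => /orP[/eqP-> |/IH le]; rewrite ?leq_addr // (leq_trans le) ?leq_addl.
pose t := [tuple inord (nth 0%N a i) : 'I_N.+1 | i < N].
rewrite /L1; apply/mapP; exists t; first by rewrite mem_enum.
have -> : [seq nat_of_ord x | x <- val t & nat_of_ord x != 0%N] =
          [seq y <- map (@nat_of_ord _) (val t) | y != 0%N].
  by rewrite [RHS]filter_map.
have -> : map (@nat_of_ord _) (val t) = a ++ nseq (N - size a) 0%N.
  apply: (@eq_from_nth _ 0%N).
    by rewrite size_map size_tuple size_cat size_nseq subnKC.
  move=> i; rewrite size_map size_tuple => iN.
  rewrite (nth_map ord0) ?size_tuple //.
  rewrite -[i]/(val (Ordinal iN)) -tnth_nth tnth_mktuple /= nth_cat nth_nseq.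
  case: ltnP => ia; first by rewrite inordK // aN // mem_nth.
  by rewrite nth_default // inordK //; case: ifP.
rewrite filter_cat [X in _ ++ X](_ : _ = [::]) ?cats0; last by elim: (N - _)%N.
by apply/esym/all_filterP/allP => x xa; apply: contraNneq a0 => <-.
Qed.

Lemma exps_cmon_of a : 0%N \notin a ->
  exps (cmon_of (iota 0 (size a)) a) = a.
Proof.
move=> a0; rewrite (@exps_sub (iota 0 (size a))); last first.
- by move=> i; apply: cmon_of_supp; rewrite size_iota.
- exact: iota_ltn_sorted.
rewrite map_cmon_of ?iota_uniq ?size_iota //.
by apply/all_filterP/allP => x xa; apply: contraNneq a0 => <-.
Qed.

(* Common part of the two characterizations: h p is the indicator of the     *)
(* class, under the relation e, of the exponent sequence p.                  *)
Lemma zspan_exps (P : pred (seq nat)) (e : rel (seq nat))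
    (h : seq nat -> pseries) f :
    (forall a, P a -> 0%N \notin a) ->
    (forall a, P a -> forall m, h a m = (e (exps m) a)%:R) ->
    (forall a, 0%N \notin a -> exists2 b, P b & e a b) ->
    (forall a b, e a b -> sumn a = sumn b) ->
    (forall a b c, P b -> P c -> e a b -> e a c -> b = c) ->
    (forall a b c, P c -> e a b -> e a c = e b c) ->
  f \in zspan (fun a : sig P => h (val a)) <->
  bounded_deg f /\ forall m m', e (exps m) (exps m') -> f m = f m'.
Proof.
move=> P0 hE ex esum euniq etr; split.
  case/zspanP => r ->; split.
    exists (\sum_(p <- r) sumn (val p.2))%N => m.
    rewrite pssum => lt; apply: big1_seq => -[z a] /= ar.
    rewrite psMz hE ?(valP a) //.
    have [/esum em|_] := boolP (e (exps m) (val a)); last by rewrite mul0rz.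
    move: lt; rewrite mdeg_exps em ltnNge (big_rem (z, a)) //=.
    by rewrite leq_addr.
  move=> m m' mm'; rewrite !pssum; apply: eq_bigr => -[z a] _ /=.
  by rewrite !psMz !hE ?(valP a) // (etr _ _ _ (valP a) mm').
case=> -[N fN] fE; apply/zspanP.
have [L [uL LP]] := exists_bounded N P0.
pose c (a : sig P) := cmon_of (iota 0 (size (val a))) (val a).
have cE (a : sig P) : exps (c a) = val a by rewrite exps_cmon_of // P0 // (valP a).
exists [seq (f (c a), a) | a : sig P <- L]; apply/funext => m.
rewrite pssum big_map.
under eq_bigr do rewrite psMz hE ?(valP _) //.
have [b Pb eb] := ex _ (exps_neq0 m).
pose B : sig P := exist _ b Pb.
have BE (a : sig P) : e (exps m) (val a) = (a == B).
  apply/idP/eqP => [ea|-> //]; apply: val_inj.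
  exact: (euniq _ _ _ (valP a) Pb ea eb).
under eq_bigr do rewrite BE.
have fB : f (c B) = f m by apply/esym/fE; rewrite cE.
have [BL|BL] := boolP (B \in L).
  rewrite (bigD1_seq B) //= eqxx fB big1 ?addr0 ?intz // => a /negPf ->.
  by rewrite mul0rz.
rewrite big1_seq; last first.
  move=> a /= aL; case: eqP => [aB|]; last by rewrite mul0rz.
  by rewrite -aB aL in BL.
apply: fN; rewrite mdeg_exps (esum _ _ eb) ltnNge.
by apply: contra BL => sb; apply: LP.
Qed.

Lemma qsym_predP f : f \in qsym_pred <->
  bounded_deg f /\ forall m m', exps m = exps m' -> f m = f m'.
Proof.
rewrite /qsym_pred (@zspan_exps (fun a => 0%N \notin a) eq_op monomial_qsym) //.
- split=> -[fN fE]; split=> // m m'; last by move=> /eqP /fE.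
  by move=> mm'; apply: fE; rewrite mm'.
- by move=> a a0 m; rewrite monomial_qsymE.
- by move=> a a0; exists a.
- by move=> a b /eqP ->.
- by move=> a b c _ _ /eqP <- /eqP.
- by move=> a b c _ /eqP ->.
Qed.

Lemma monomial_symE l m : 0%N \notin l ->
  monomial_sym l m = (perm_eq (exps m) l)%:R.
Proof.
move=> l0; rewrite /monomial_sym pssum.
under eq_big_seq => a.
  rewrite mem_permutations => al; rewrite monomial_qsymE; last first.
    by rewrite (perm_mem al).
  over.
rewrite -mem_permutations; have [ml|ml] := boolP (exps m \in permutations l).
  rewrite (bigD1_seq (exps m)) ?permutations_uniq //= eqxx big1 ?addr0 //.
  by move=> a; rewrite eq_sym => /negPf ->.
by rewrite big1_seq // => a /= al; case: eqP al ml => // -> ->.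
Qed.

Lemma sym_predP f : f \in sym_pred <->
  bounded_deg f /\ forall m m', perm_eq (exps m) (exps m') -> f m = f m'.
Proof.
have geT : total geq by move=> x y; rewrite /geq /= leq_total.
have geTr : transitive geq by move=> x y z /= xy yz; exact: leq_trans yz xy.
have geA : antisymmetric geq by move=> x y /=; rewrite andbC -eqn_leq => /eqP.
apply: zspan_exps => //.
- by move=> a /andP[].
- by move=> a /andP[a0 _] m; rewrite monomial_symE.
- move=> a a0; exists (sort geq a); last by rewrite perm_sym perm_sort.
  by rewrite (perm_mem (s2 := a)) ?perm_sort // a0 sort_sorted.
- by move=> a b ab; rewrite !sumnE; exact: perm_big.
- move=> a b c /andP[_ sb] /andP[_ sc] ab ac.
  by apply: (sorted_eq geTr geA) => //; rewrite perm_sym in ab; apply: perm_trans ac.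
- move=> a b c _ ab; apply/idP/idP; last exact: perm_trans.
  by apply: perm_trans; rewrite perm_sym.
Qed.

Lemma sym_qsym f : f \in sym_pred -> f \in qsym_pred.
Proof.
by case/sym_predP => fN fE; apply/qsym_predP; split=> // m m' mm'; apply: fE; rewrite mm'.
Qed.

Lemma bounded_degM f g : bounded_deg f -> bounded_deg g -> bounded_deg (f * g).
Proof.
move=> [N fN] [N' gN]; exists (N + N')%N => m lt.
rewrite [LHS]fsbig1 // => -[u v] /= uv.
case: (ltnP N (mdeg u)) => [/fN->|uN]; first by rewrite mul0r.
rewrite gN ?mulr0 // -(ltn_add2l N) (leq_trans lt) // -uv mdegM leq_add2r //.
Qed.

Lemma psmul_relabel f g s s' m m' :
    uniq s -> uniq s' -> size s = size s' ->
    (forall i, m i != 0%N -> i \in s) -> (forall i, m' i != 0%N -> i \in s') ->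
    map m s = map m' s' ->
    (forall u, (forall i, u i != 0%N -> i \in s) ->
       f u = f (cmon_of s' (map u s)) /\ g u = g (cmon_of s' (map u s))) ->
  (f * g) m = (f * g) m'.
Proof.
move=> us us' ss ms ms' mm' fg.
pose h u := cmon_of s' (map u s).
have dvdl (t : seq nat) u v (k : {cmonom nat}) : (forall i, k i != 0%N -> i \in t) -> mmul u v = k ->
    forall i : nat, u i != 0%N -> i \in t.
  move=> kt uv i ui; apply: kt; rewrite -uv cmM addn_eq0 negb_and.
  by rewrite ui.
have hM u v : h (mmul u v) = mmul (h u) (h v).
  apply/eqP/cmP => i; rewrite cmM !cmon_ofE ?size_map //.
  have [is'|is'] := ltnP (index i s') (size s).
    by rewrite !(nth_map 0%N) // cmM.
  by rewrite !nth_default ?size_map.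
have hm : h m = m' by rewrite /h mm' cmon_ofK.
have hinj u v : (forall i, u i != 0%N -> i \in s) ->
    (forall i, v i != 0%N -> i \in s) -> h u = h v -> u = v.
  move=> hu hv /(congr1 (fun k : {cmonom nat} => map k s')).
  by rewrite !map_cmon_of ?size_map // => E; rewrite -(cmon_ofK us hu) E cmon_ofK.
pose h2 (p : {cmonom nat} * {cmonom nat}) := (h p.1, h p.2).
rewrite [LHS]/(psmul f g m) [RHS]/(psmul f g m') /psmul.
rewrite (@reindex_fsbig _ _ _ _ _ h2 [set p | mmul p.1 p.2 = m]
  [set p | mmul p.1 p.2 = m']); last first.
  split.
  - by move=> [u v] /= uv; rewrite -hM uv hm.
  - move=> [u v] [u' v']; rewrite !inE /= => uv uv' [] hu hv.
    have uv2 : mmul v u = m by rewrite mulmC.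
    have uv2' : mmul v' u' = m by rewrite mulmC.
    by rewrite (hinj u u' (dvdl _ _ _ _ ms uv) (dvdl _ _ _ _ ms uv') hu)
               (hinj v v' (dvdl _ _ _ _ ms uv2) (dvdl _ _ _ _ ms uv2') hv).
  move=> [u v] /= uv.
  have vu : mmul v u = m' by rewrite mulmC.
  pose k (x : {cmonom nat}) := cmon_of s (map x s').
  have kh (x : {cmonom nat}) :
      (forall i, x i != 0%N -> i \in s') -> h (k x) = x.
    by move=> hx; rewrite /h map_cmon_of ?size_map // cmon_ofK.
  exists (k u, k v); last first.
    by rewrite /h2 /= !kh //; [exact: dvdl vu | exact: dvdl uv].
  apply: hinj => //.
    move=> i; rewrite cmM addn_eq0 negb_and.
    by case/orP; apply: cmon_of_supp; rewrite size_map.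
  by rewrite hM !kh ?uv ?hm //; [exact: dvdl vu | exact: dvdl uv].
apply: eq_fsbigr => -[u v]; rewrite inE /= => uv.
have vu : mmul v u = m by rewrite mulmC.
by rewrite (fg u (dvdl _ _ _ _ ms uv)).1 (fg v (dvdl _ _ _ _ ms vu)).2.
Qed.

Lemma qsym_subring : subring_closed qsym_pred.
Proof.
split; last 2 first.
- by have [] := zspan_zmod (fun a : composition => monomial_qsym (val a)).
- move=> f g /qsym_predP[fN fE] /qsym_predP[gN gE]; apply/qsym_predP.
  split; first exact: bounded_degM.
  move=> m m' mm'; apply: (psmul_relabel _ _ _ _ _ mm');
    rewrite ?sort_uniq ?fset_uniq //.
  + by have /(congr1 size) := mm'; rewrite !size_map.
  + by move=> i; rewrite mem_sort cmE_neq0.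
  + by move=> i; rewrite mem_sort cmE_neq0.
  move=> u us; suff E : exps u = exps (cmon_of (sort leq (finsupp m'))
      [seq u i | i <- sort leq (finsupp m)]) by split; [apply: fE | apply: gE].
  have sz : size [seq u i | i <- sort leq (finsupp m)] = size (sort leq (finsupp m')).
    by have /(congr1 size) := mm'; rewrite !size_map.
  rewrite (exps_sub (sorted_finsupp m) us) (exps_sub (sorted_finsupp m')).
    by rewrite map_cmon_of // sort_uniq fset_uniq.
  by move=> i; apply: cmon_of_supp.
apply/qsym_predP; split.
  by exists 0%N => m m0; rewrite [LHS]/(psmono mone m) /psmono -mdeg_eq0 -leqn0 leqNgt m0.
move=> m m' mm'; rewrite [LHS]/(psmono mone m) [RHS]/(psmono mone m') /psmono.
by rewrite -!mdeg_eq0 !mdeg_exps mm'.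
Qed.

Lemma sym_subring : subring_closed sym_pred.
Proof.
split; last 2 first.
- by have [] := zspan_zmod (fun l : integer_partition => monomial_sym (val l)).
- move=> f g /sym_predP[fN fE] /sym_predP[gN gE]; apply/sym_predP.
  split; first exact: bounded_degM.
  move=> m m' mm'.
  pose s := sort leq (finsupp m); pose t := sort leq (finsupp m').
  have us : uniq s by rewrite sort_uniq fset_uniq.
  have ut : uniq t by rewrite sort_uniq fset_uniq.
  have [I pI EI] := perm_iotaP 0%N mm'.
  have szt : size (exps m') = size t by rewrite size_map.
  pose s' := map (nth 0%N t) I.
  have ps' : perm_eq s' t.
    by rewrite -[X in perm_eq _ X](mkseq_nth 0%N) perm_map // -szt.
  have us' : uniq s' by rewrite (perm_uniq ps').
  have sE : map m s = map m' s'.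
    rewrite -[LHS]/(exps m) EI -map_comp; apply/eq_in_map => i.
    rewrite (perm_mem pI) mem_iota /= szt => it.
    by rewrite (nth_map 0%N).
  have sz : size s = size s' by have /(congr1 size) := sE; rewrite !size_map.
  apply: (psmul_relabel us us' sz) => //.
  + by move=> i; rewrite mem_sort cmE_neq0.
  + by move=> i; rewrite (perm_mem ps') mem_sort cmE_neq0.
  move=> u hu; suff E : perm_eq (exps u) (exps (cmon_of s' [seq u i | i <- s])).
    by split; [apply: fE | apply: gE].
  have sz' : size [seq u i | i <- s] = size s' by rewrite size_map.
  apply: (perm_trans (exps_perm us hu)); rewrite perm_sym.
  apply: (perm_trans (exps_perm us' _)); last by rewrite map_cmon_of.
  by move=> i; apply: cmon_of_supp.
apply/sym_predP; split.
  by exists 0%N => m m0; rewrite [LHS]/(psmono mone m) /psmono -mdeg_eq0 -leqn0 leqNgt m0.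
move=> m m' mm'; rewrite [LHS]/(psmono mone m) [RHS]/(psmono mone m') /psmono.
by rewrite -!mdeg_eq0 !mdeg_exps !sumnE (perm_big _ mm').
Qed.

End QSymClosed.

HB.instance Definition _ :=
  GRing.isSubringClosed.Build pseries qsym_pred qsym_subring.
HB.instance Definition _ :=
  GRing.isSubringClosed.Build pseries sym_pred sym_subring.

Record QSym := MkQSym { qsym_val : pseries; qsym_valP : qsym_val \in qsym_pred }.

HB.instance Definition _ := [isSub for qsym_val].
HB.instance Definition _ := [Choice of QSym by <:].
HB.instance Definition _ := [SubChoice_isSubComNzRing of QSym by <:].

Record Sym := MkSym { sym_val : pseries; sym_valP : sym_val \in sym_pred }.

HB.instance Definition _ := [isSub for sym_val].
HB.instance Definition _ := [Choice of Sym by <:].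
HB.instance Definition _ := [SubChoice_isSubComNzRing of Sym by <:].

Definition sym_in_qsym (s : Sym) : QSym := MkQSym (sym_qsym (sym_valP s)).

Lemma qsym_valM (f g : QSym) : val (f * g) = val f * val g.
Proof. exact: rmorphM. Qed.

Lemma qsym_val1 : val (1 : QSym) = 1.
Proof. exact: rmorph1. Qed.

Lemma sym_valM (s t : Sym) : val (s * t) = val s * val t.
Proof. exact: rmorphM. Qed.

Lemma sym_val1 : val (1 : Sym) = 1.
Proof. exact: rmorph1. Qed.

Lemma val_sym_in_qsym (s : Sym) : val (sym_in_qsym s) = val s.
Proof. by []. Qed.

Lemma sym_in_qsym_zmod : zmod_morphism sym_in_qsym.
Proof. by move=> s t; apply: val_inj. Qed.

Lemma sym_in_qsym_monoid : monoid_morphism sym_in_qsym.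
Proof.
split=> [|s t]; apply: val_inj; rewrite val_sym_in_qsym.
  by rewrite sym_val1 qsym_val1.
by rewrite sym_valM qsym_valM !val_sym_in_qsym.
Qed.

HB.instance Definition _ :=
  GRing.isZmodMorphism.Build Sym QSym sym_in_qsym sym_in_qsym_zmod.
HB.instance Definition _ :=
  GRing.isMonoidMorphism.Build Sym QSym sym_in_qsym sym_in_qsym_monoid.

Definition sym_scale (s : Sym) (f : QSym) : QSym := sym_in_qsym s * f.

Lemma sym_scaleA s t f : sym_scale s (sym_scale t f) = sym_scale (s * t) f.
Proof. by rewrite /sym_scale rmorphM mulrA. Qed.

Lemma sym_scale1 : left_id 1 sym_scale.
Proof. by move=> f; rewrite /sym_scale rmorph1 mul1r. Qed.

Lemma sym_scaleDr : right_distributive sym_scale +%R.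
Proof. by move=> s f g; rewrite /sym_scale mulrDr. Qed.

Lemma sym_scaleDl f : {morph sym_scale^~ f : s t / s + t}.
Proof. by move=> s t; rewrite /sym_scale rmorphD mulrDl. Qed.

HB.instance Definition _ := GRing.Zmodule_isLmodule.Build Sym QSym
  sym_scaleA sym_scale1 sym_scaleDr sym_scaleDl.

Lemma qsym_valZ (s : Sym) (f : QSym) : val (s *: f) = val s * val f.
Proof. exact: qsym_valM. Qed.

(* Main.v *)
Require Import Defs.
From mathcomp Require Import all_boot all_order all_algebra.
From mathcomp Require Import finmap.
From mathcomp.multinomials Require Import monalg.
From mathcomp.classical Require Import boolp classical_sets fsbigop.

(* Order compositions by length, then lexicographically. Among the            *)
(* compositions w with M_w occurring in m_k M_u, the largest are shuffles of  *)
(* u with a rearrangement of the partition k, and the very largest one is the *)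
(* greedy merge of u and k, which always takes the larger of the two heads.   *)
(* Call u reduced if its Lyndon factorization has no factor of length one.    *)
(* Each composition is the merge of exactly one reduced u and one partition   *)
(* k, and for reduced u only one shuffle attains it, so that                  *)
(* m_k M_u = M_w + smaller terms. By triangularity the M_u with u reduced     *)
(* form a basis over Sym.                                                     *)

(** Given that m_k M_u has leading word [merge geq u k] with coefficient 1, and that these words run
    exactly once through all compositions, the argument is that of a unitriangular matrix. Existence
    and uniqueness of the merge decomposition are [merge_decomp] and [merge_inj]. A factorization of
    the monomial of a word w into a monomial of m_k and one of M_u is a list of pairs of exponents,
    that is, a way to obtain w as a quasi-shuffle of a rearrangement of k with u. [base_val_psum_le]
    bounds every such w by the merge, and [shuffling_uniq] shows that for reduced u a single list
    reaches it, so the leading coefficient is 1 and no division is required over the integers.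
    [reduced_qsym_span_below] eliminates the largest word of f; [reduced_qsym_free] finds a nonzero
    coefficient at the largest merge. *)

Set Implicit Arguments.
Unset Strict Implicit.
Unset Printing Implicit Defensive.

Import GRing.Theory.

(** * Words *)

(* On words of positive letters smaller than B, the order of the values is    *)
(* the order by length, then lexicographic.                                   *)
Fixpoint base_val (B : nat) (s : seq nat) : nat :=
  if s is x :: t then x * B ^ size t + base_val B t else 0.

Lemma base_val_lt B s : all (gtn B) s -> base_val B s < B ^ size s.
Proof.
elim: s => //= x s IH /andP[xB /IH {}IH]; rewrite expnS.
apply: leq_trans (leq_mul xB (leqnn _)).
by rewrite mulSn addnC ltn_add2r.
Qed.

Lemma base_val_ge B x s : 0 < x -> B ^ size s <= base_val B (x :: s).
Proof. by case: x => // x _ /=; rewrite mulSn -addnA leq_addr. Qed.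

Lemma base_val_lt_cons B x y s t : size s = size t -> all (gtn B) s ->
  x < y -> base_val B (x :: s) < base_val B (y :: t).
Proof.
move=> st /base_val_lt sB xy /=; rewrite -st.
apply: leq_trans (leq_addr _ _); apply: leq_trans (leq_mul xy (leqnn _)).
by rewrite mulSn addnC ltn_add2r.
Qed.

Lemma base_val_lt_size B s t : 0 < B -> all (gtn B) s -> 0 \notin t ->
  size s < size t -> base_val B s < base_val B t.
Proof.
case: t => // x t B0 /base_val_lt sB; rewrite inE negb_or eq_sym -lt0n.
case/andP=> x0 _ st; apply: leq_trans (base_val_ge B t x0).
by apply: leq_trans sB _; rewrite leq_pexp2l.
Qed.

Lemma base_val_inj B s t : 0 < B -> all (gtn B) s -> all (gtn B) t ->
  0 \notin s -> 0 \notin t -> base_val B s = base_val B t -> s = t.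
Proof.
move=> B0 sB tB s0 t0 st.
have sz : size s = size t.
  have [lt|lt|//] := ltngtP (size s) (size t).
    by have := base_val_lt_size B0 sB t0 lt; rewrite st ltnn.
  by have := base_val_lt_size B0 tB s0 lt; rewrite st ltnn.
elim: s t sz sB tB st {s0 t0} => [|x s IH] [|y t] //= [sz] /andP[_ sB] /andP[_ tB] st.
have [lt|lt|xy] := ltngtP x y.
- by have := base_val_lt_cons sz sB lt; rewrite /= st ltnn.
- by have := base_val_lt_cons (esym sz) tB lt; rewrite /= st ltnn.
by rewrite xy (IH t) //; move: st; rewrite xy sz => /addnI.
Qed.

(** Equivalently, [s] is lexicographically smaller than [x :: s]. When [x] is at most every earlier
    letter, this makes it a Lyndon factor of length one. *)
Fixpoint descends (x : nat) (s : seq nat) : bool :=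
  if s is y :: t then (y < x) || (y == x) && descends x t else true.

(* No letter x that is at most m and at most every earlier letter is followed *)
(* by some x's and then by a smaller letter or the end of the word.           *)
Fixpoint reduced_below (m : nat) (u : seq nat) : bool :=
  if u is x :: t then
    if x <= m then ~~ descends x t && reduced_below x t else reduced_below m t
  else true.

Definition reduced (u : seq nat) : bool := reduced_below (head 0 u) u.

Lemma reduced_below_le m n u :
  m <= n -> reduced_below n u -> reduced_below m u.
Proof.
elim: u m n => //= x u IH m n mn.
have [xm|mx] := leqP x m; first by rewrite (leq_trans xm mn).
have [xn|nx] := leqP x n; last exact: IH.
by case/andP => _; apply: IH; apply: ltnW.
Qed.

Lemma reduced_belowW m u : reduced u -> reduced_below m u.
Proof.
case: u => //= x u; rewrite /reduced /= leqnn => xu.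
have [//|mx] := leqP x m.
by apply: reduced_below_le (ltnW mx) _; case/andP: xu.
Qed.

Lemma reduced_belowT m u : all (geq m) u -> reduced_below m u -> reduced u.
Proof. by case: u => //= x u /andP[xm _]; rewrite /reduced /= xm leqnn. Qed.

(** * Unique decomposition of a word as a greedy merge *)

Lemma merges0 (u : seq nat) : merge geq u [::] = u.
Proof. by case: u. Qed.

Lemma merge_path_l z u l : path geq z l ->
  merge geq (z :: u) l = z :: merge geq u l.
Proof. by case: l => [|a l] /=; rewrite ?merges0 // => /andP[->]. Qed.

Definition head_lt (z : nat) (u : seq nat) : bool :=
  if u is x :: _ then x < z else true.

Lemma merge_lt_head z u l : head_lt z u ->
  merge geq u (z :: l) = z :: merge geq u l.
Proof. by case: u => [|x u] //=; rewrite ltnNge => /negPf ->. Qed.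

Lemma geq_trans : transitive geq.
Proof. by move=> x y z /= xy yz; exact: leq_trans yz xy. Qed.

(** Ties in [merge geq] go to the left word, hence a weak bound on [l] in the first case and the
    strict [head_lt] in the second. *)
Variant merge_spec (z : nat) (t u l : seq nat) : Prop :=
| MergeL u' of u = z :: u' & t = merge geq u' l & path geq z l
| MergeR l' of l = z :: l' & t = merge geq u l' & path geq z l'
    & head_lt z u.

Lemma mergeP z t u l : sorted geq l -> merge geq u l = z :: t ->
  merge_spec z t u l.
Proof.
case: l => [|a l]; first by rewrite merges0 => _ ->; apply: MergeL; rewrite ?merges0.
case: u => [|x u] /=; first by move=> sl [<- <-]; apply: MergeR.
move=> sl; case: leqP => xa [<- <-]; last exact: MergeR.
by apply: MergeL => //=; rewrite xa.
Qed.

(** A letter of [l] is taken only when [u] is exhausted or its head is below that letter, hence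
    below [x]. By then [u] has descended, and inserting weakly decreasing letters at most [x] cannot
    undo this. *)
Lemma descends_merge x u l : path geq x l ->
  descends x (merge geq u l) = descends x u.
Proof.
elim: u => [|y u IHu] in l *.
  by elim: l => [|a l IHl] //= /andP[ax]; case: ltngtP ax => //= -> _ /IHl.
elim: l => [|a l IHl]; first by rewrite merges0.
move=> al; have /= /andP[ax al'] := al.
have [ay|ya] := leqP a y; first by rewrite /= (IHu (a :: l)).
have yx : y < x by exact: leq_trans ax.
move: IHl al' => /=; rewrite yx /=; case: ltngtP ax => //= ax _; rewrite ax.
by move=> IHl /IHl.
Qed.

(** The threshold [m] stands for the least earlier letter. After the tail is decomposed, the head
    [z] goes to the partition exactly when it is a Lyndon factor of length one; by [descends_merge]
    this can be tested on [u] alone. *)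
Lemma merge_decomp m w : exists u l,
  [/\ w = merge geq u l, path geq m l & reduced_below m u].
Proof.
elim: w m => [|z t IH] m; first by exists [::], [::].
have [zm|mz] := leqP z m; last first.
  have [u [l [-> lm um]]] := IH m; exists (z :: u), l; split=> //.
    by rewrite merge_path_l // (path_le geq_trans _ lm) //= ltnW.
  by rewrite /= leqNgt mz.
have [u [l [tE lz uz]]] := IH z.
have [dz|dz] := boolP (descends z u); last first.
  exists (z :: u), l; split; first by rewrite merge_path_l // tE.
    exact: (path_le geq_trans _ lz).
  by rewrite /= zm dz.
(* A head equal to [z] would itself have to descend, which reducedness at threshold [z] forbids. *)
have uhead : head_lt z u.
  case: u dz uz {tE} => //= x u; case: ltngtP => //= -> ->.
  by [].
exists u, (z :: l); split; first by rewrite tE merge_lt_head.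
  by rewrite /= /= zm.
case: u uz uhead {tE dz} => //= x u; case: ltngtP => //= xz.
by rewrite (leq_trans (ltnW xz) zm).
Qed.

(** The first letter [z] of the merge comes from the same side in both decompositions: the rest of
    the merge does not descend from [z] if [z] is a tested letter of the reduced word, and does if
    [z] belongs to the partition. *)
Lemma merge_inj m u l u' l' : path geq m l -> path geq m l' ->
  reduced_below m u -> reduced_below m u' ->
  merge geq u l = merge geq u' l' -> u = u' /\ l = l'.
Proof.
move wE: (merge geq u l) => w.
elim: w m u l u' l' wE => [|z t IH] m u l u' l' wE lm lm' um um' wE'.
  have := congr1 size wE; have := congr1 size wE'.
  rewrite !size_merge !size_cat /= => /esym/eqP; rewrite addn_eq0 => /andP[/nilP-> /nilP->].
  by move=> /eqP; rewrite addn_eq0 => /andP[/nilP-> /nilP->].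
have clash v k v' k' : path geq m k' -> reduced_below m (z :: v) ->
    path geq z k -> path geq z k' -> head_lt z v' ->
    z <= m -> t = merge geq v k -> t = merge geq v' k' -> False.
  move=> km vm kz kz' vz zm tE tE'.
  move: vm => /=; rewrite zm => /andP[+ _]; rewrite -(descends_merge _ kz) -tE tE'.
  by rewrite descends_merge //; case: (v') vz => //= x s ->.
have := mergeP (path_sorted lm) wE; have := mergeP (path_sorted lm') (esym wE').
have P n k : path geq n (z :: k) -> z <= n by case/andP.
have Q n k : path geq n (z :: k) -> path geq n k.
  by apply: subseq_path; [exact: geq_trans | exact: subseq_cons].
case=> [v' uE' tE' lz'|k' lE' tE' lz' uz']; case=> [v uE tE lz|k lE tE lz uz].
- subst u u'; have [zm|mz] := leqP z m.
    move: um um' => /=; rewrite zm => /andP[_ vz] /andP[_ vz'].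
    by have [-> ->] := IH z v l v' l' (esym tE) lz lz' vz vz' tE'.
  move: um um' => /=; rewrite leqNgt mz /= => vm vm'.
  by have [-> ->] := IH m v l v' l' (esym tE) lm lm' vm vm' tE'.
- subst u' l; case: (clash v' l' u k) => //; [exact: Q lm | exact: P lm].
- subst u l'; case: (clash v l u' k') => //; [exact: Q lm' | exact: P lm'].
- subst l l'.
  by have [-> ->] := IH m u k u' k' (esym tE) (Q _ _ lm) (Q _ _ lm') um um' tE'.
Qed.

(** * Shuffles as lists of pairs *)

Definition nonzeros (s : seq nat) := [seq x <- s | x != 0].
(* A list of pairs (p, q) with p + q > 0 encodes a way in which the word of   *)
(* the sums p + q occurs in the quasi-shuffle product of the word of the      *)
(* nonzero p by the word of the nonzero q.                                    *)
Definition psum (l : seq (nat * nat)) := [seq p.1 + p.2 | p <- l].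
Definition lpart (l : seq (nat * nat)) := nonzeros [seq p.1 | p <- l].
Definition rpart (l : seq (nat * nat)) := nonzeros [seq p.2 | p <- l].
(** The shuffles are the quasi-shuffles that add no two letters; the exclusive or also rules out the
    pair (0, 0). *)
Definition shuffling (l : seq (nat * nat)) :=
  all (fun p => (p.1 == 0) (+) (p.2 == 0)) l.


(* A letter of the right word may be reassigned to the left one, whose order  *)
(* does not matter.                                                           *)
Lemma shuffling_swap x u l : shuffling l -> rpart l = x :: u ->
  exists l', [/\ shuffling l', psum l' = psum l,
    perm_eq (lpart l') (x :: lpart l) & rpart l' = u].
Proof.
elim: l => //= -[p q] l IH /= /andP[].
rewrite /rpart /lpart /=; case: p => [|p]; case: q => [|q] //= _ cl.
  case=> <- <-; exists ((q.+1, 0) :: l); split => //.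
  by rewrite /= addn0.
move=> /(IH cl)[l' [cl' <- pl <-]]; exists ((p.+1, 0) :: l'); split => //=.
by rewrite -(perm_cons p.+1) in pl; apply: (perm_trans pl); rewrite (perm_catCA [:: _] [:: _]).
Qed.

Lemma size_psum l : size (psum l) = size l.
Proof. exact: size_map. Qed.

Lemma size_shuffling l : shuffling l ->
  size l = size (lpart l) + size (rpart l).
Proof.
elim: l => //= -[[|p] [|q]] l IH //= /IH ->;
  by rewrite /rpart /lpart /= ?addnS.
Qed.

Lemma size_pairs l : 0 \notin psum l -> ~~ shuffling l ->
  size l < size (lpart l) + size (rpart l).
Proof.
have le k : 0 \notin psum k -> size k <= size (lpart k) + size (rpart k).
  elim: k => //= -[[|p] [|q]] k IH //=; rewrite inE /= => /IH;
  rewrite /rpart /lpart /= ?addnS ?addSn ?ltnS // => /leqW //.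
elim: l => //= -[[|p] [|q]] l IH //=; rewrite inE /= => l0.
- by move/(IH l0); rewrite /rpart /lpart /= addnS ltnS.
- by rewrite /rpart /lpart /= addnS addSn !ltnS => _; apply: le.
Qed.

(** No shuffle can start with a letter larger than the head of the merge; if the heads agree, the
    tails are compared. The induction is on length because a tie replaces the tail by another
    list. *)
Lemma shuffling_le B u k l : shuffling l -> all (gtn B) (psum l) ->
  sorted geq k -> perm_eq (lpart l) k -> rpart l = u ->
  base_val B (psum l) <= base_val B (merge geq u k).
Proof.
move: {2}(size l) (leqnn (size l)) => n.
elim: n l u k => [|n IH] [|[p q] l] // u k ln cl lB sk pk ru.
have sz : size (psum ((p, q) :: l)) = size (merge geq u k).
  rewrite size_psum size_merge size_cat size_shuffling // ru (perm_size pk).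
  by rewrite addnC.
have /= /andP[pqB lB'] := lB; have /= /andP[pq cl'] := cl.
have lt z t : merge geq u k = z :: t -> p + q < z ->
    base_val B (psum ((p, q) :: l)) <= base_val B (merge geq u k).
  move=> E pz; rewrite E in sz *; apply/ltnW/base_val_lt_cons => //.
  by case: sz.
have eq z t : merge geq u k = z :: t -> p + q = z ->
    base_val B (psum l) <= base_val B t ->
    base_val B (psum ((p, q) :: l)) <= base_val B (merge geq u k).
  move=> E pz; rewrite E in sz * => le /=; rewrite pz; case: sz => ->.
  by rewrite leq_add2l.
have [[p0 qn]|[pn q0]] : (p = 0 /\ 0 != q) \/ (0 != p /\ q = 0).
- by case: (p) (q) pq => [|?] [|?] // _; [left | right].
- subst p; rewrite /lpart /= in pk; rewrite /rpart /= eq_sym qn in ru; subst u.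
  have go : path geq q k -> base_val B (psum ((0, q) :: l)) <=
      base_val B (merge geq (q :: nonzeros [seq p.2 | p <- l]) k).
    by move=> qk; apply: eq (merge_path_l _ qk) _ _ => //; apply: IH.
  case: k sk pk => [|a k] sk pk in sz lt eq go *; first exact: go.
  have [aq|qa] := leqP a q; first by apply: go => //=; rewrite aq.
  exact: lt (merge_lt_head (u := q :: _) k qa) qa.
subst q; rewrite /lpart /= eq_sym pn in pk; rewrite /rpart /= in ru.
case: k sk pk => [|a k] sk pk in sz lt eq *; first by have := perm_size pk.
have pa : p <= a.
  have := perm_mem pk p; rewrite inE eqxx /= => /esym.
  rewrite inE; case/orP => [/eqP-> //|pk'].
  by have /allP/(_ _ pk') := order_path_min geq_trans sk.
have goR : head_lt a u ->
    base_val B (psum ((p, 0) :: l)) <= base_val B (merge geq u (a :: k)).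
  move=> ua; have E := merge_lt_head k ua.
  move: pa; rewrite leq_eqVlt => /orP[/eqP pa|pa]; last by apply: lt E _; rewrite addn0.
  apply: eq E _ _; rewrite ?addn0 //; apply: IH => //; first exact: path_sorted sk.
  by rewrite -(perm_cons a) -{1}pa.
case: u ru => [|x u] ru in sz lt eq goR *; first exact: goR.
have [ax|xa] := leqP a x; last exact: goR.
have E : merge geq (x :: u) (a :: k) = x :: merge geq u (a :: k) by rewrite /= ax.
have := leq_trans pa ax; rewrite leq_eqVlt => /orP[/eqP px|px]; last by apply: lt E _; rewrite addn0.
have ax' : a = x by apply/eqP; rewrite eqn_leq ax -px pa.
(* Here [l] takes the letter [x] from the rearrangement of [k] while the merge takes it from [u].
   The two equal letters exchange roles: the later [x] of [u] is now counted in [k]. *)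
have [l' [cl2 ll' pl' rl']] := shuffling_swap cl' ru.
apply: eq E _ _; rewrite ?addn0 // -ll'; apply: IH => //.
- by rewrite -(size_psum l') ll' size_psum.
- by rewrite ll'.
- by apply: (perm_trans pl'); rewrite -px.
Qed.

(** Such a [u] starts with copies of [z] followed by a larger letter; delaying the extra [z] brings
    that larger letter one place forward. *)
Lemma base_val_merge_lt B z u k : ~~ descends z u -> path geq z k ->
  all (gtn B) (merge geq u (z :: k)) ->
  base_val B (z :: merge geq u k) < base_val B (merge geq u (z :: k)).
Proof.
move=> + zk; elim: u => // y u IH dy.
have [yz zy] : (y == z -> ~~ descends z u) /\ z <= y.
  by move: dy; rewrite /= negb_or negb_and -leqNgt => /andP[-> /orP[/negP|]].
have S : size (merge geq (y :: u) k) = size (merge geq u (z :: k)).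
  by rewrite !size_merge !size_cat /= addnS.
rewrite [merge geq (y :: u) (z :: k)]/= zy => /andP[yB kB].
move: zy; rewrite leq_eqVlt => /orP[/eqP zy|zy].
  subst y; rewrite [in X in X < _]/base_val -/base_val [in X in _ < X]/base_val -/base_val.
  by rewrite S ltn_add2l merge_path_l //; apply: IH => //; apply: yz.
apply: base_val_lt_cons => //.
apply/allP => x xy; move/allP: kB => kB.
move: xy; rewrite mem_merge mem_cat inE => /orP[/orP[/eqP->//|xu]|xk].
  by apply: kB; rewrite mem_merge mem_cat xu.
by apply: kB; rewrite mem_merge mem_cat inE xk !orbT.
Qed.

(** A choice arises only when [u] is [z :: v] and [k] is [z :: k']. Taking [z] from [k] leaves a
    shuffle of [u] with a rearrangement of [k'], at most [z :: merge geq v k'] by [shuffling_le]. By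
    [base_val_merge_lt] this is below the required [merge geq v k], since reducedness keeps [v] from
    descending from [z]. *)
Lemma shuffling_uniq m u k l l' : path geq m k -> reduced_below m u ->
  shuffling l -> psum l = merge geq u k -> perm_eq (lpart l) k -> rpart l = u ->
  shuffling l' -> psum l' = merge geq u k -> perm_eq (lpart l') k -> rpart l' = u ->
  l = l'.
Proof.
elim: l l' m u k => [|[p q] l IH] l' m u k km um.
  by move=> _ <- _ _ _ /eqP; rewrite -size_eq0 size_psum => /nilP.
case: l' => [|[p' q'] l'] cl lE pl rl cl' lE' pl' rl'.
  by rewrite -lE' in lE.
have /= /andP[pq cl1] := cl; have /= /andP[pq' cl1'] := cl'.
have [zE tlE] : p + q = p' + q' /\ psum l = psum l'.
  by move: lE; rewrite -lE' => -[-> ->].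
have Q n z s : path geq n (z :: s) -> path geq n s.
  by apply: subseq_path; [exact: geq_trans | exact: subseq_cons].
have := mergeP (path_sorted km) (esym lE).
case=> [v uE tE kz|h kE tE hz uz]; last first.
  have R a b s : rpart ((a, b) :: s) = u -> a + b = p + q -> (a == 0) (+) (b == 0) ->
      b = 0.
    case: a b => [|a] [|b] // E ab; rewrite -E /= -ab in uz.
    by rewrite ltnn in uz.
  have q0 := R _ _ _ rl erefl pq; have q0' := R _ _ _ rl' (esym zE) pq'; subst q q'.
  rewrite !addn0 in zE; subst p'.
  rewrite addn0 in kE; subst k; congr cons.
  rewrite eqxx addbT in pq.
  rewrite /lpart /= pq !perm_cons in pl pl'.
  apply: (IH l' m u h) => //; first exact: Q km.
  by rewrite -tlE.
have bad s : shuffling s -> rpart s = u -> perm_eq (p + q :: lpart s) k ->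
    psum s = merge geq v k -> False.
  move=> cs rs ps sE.
  case: k kz => [|a k] kz in km lE pl lE' pl' tE ps sE *; first by have := perm_size ps.
  have aE : a = p + q.
    apply/eqP; rewrite eqn_leq; have /= /andP[-> ak] := kz.
    have := perm_mem ps (p + q); rewrite inE eqxx /= => /esym.
    rewrite inE; case/orP => [/eqP-> //|pk'].
    by have /allP/(_ _ pk') := order_path_min geq_trans ak.
  rewrite aE in ps sE km kz tE lE.
  have /= /andP[am _] := km; have /= /andP[_ ak] := kz.
  rewrite perm_cons in ps.
  move: um; rewrite uE /= am => /andP[dv _].
  (* The base only has to exceed every letter. *)
  pose B := (sumn (psum s)).+1.
  have sB : all (gtn B) (psum s).
    apply/allP => x; rewrite /= ltnS; elim: (psum s) => //= y r IHr.
    rewrite inE => /orP[/eqP->|/IHr]; first exact: leq_addr.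
    by move=> /leq_trans; apply; exact: leq_addl.
  have := shuffling_le cs sB (path_sorted ak) ps rs.
  rewrite uE merge_path_l // leqNgt sE base_val_merge_lt // -sE //.
have R a b s : rpart ((a, b) :: s) = u -> (a == 0) (+) (b == 0) -> shuffling s ->
    psum ((a, b) :: s) = merge geq u k -> perm_eq (lpart ((a, b) :: s)) k ->
    a = 0 /\ rpart s = v.
  rewrite -lE => E ab cs [abE sE] ps.
  have sE' : psum s = merge geq v k by rewrite [LHS]sE.
  case: a b E ab abE ps => [|a] [|b] //= E _ abE ps.
    by move: E; rewrite /rpart /= uE => -[_ ->].
  by case: (bad s) => //; rewrite -abE addn0.
have [p0 rv] := R _ _ _ rl pq cl1 lE pl.
have [p0' rv'] := R _ _ _ rl' pq' cl1' lE' pl'.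
subst p p'; rewrite !add0n in zE; subst q'; congr cons.
have tE' : psum l' = merge geq v k by rewrite -tlE.
rewrite add0n in kz uE; rewrite uE /= in um.
have [qm|mq] := leqP q m.
  by move: um; rewrite qm => /andP[_ vq]; apply: (IH l' q v k).
by move: um; rewrite leqNgt mq => vm; apply: (IH l' m v k).
Qed.

Lemma shuffling_exists u k : 0 \notin u -> 0 \notin k ->
  exists l, [/\ shuffling l, psum l = merge geq u k, lpart l = k & rpart l = u].
Proof.
move=> u0 k0.
have nz s : 0 \notin s -> nonzeros s = s.
  by move=> s0; apply/all_filterP/allP => x xs; apply: contraNneq s0 => <-.
elim: u u0 => [|x u IHu] u0 in k k0 *.
  exists [seq (a, 0) | a <- k]; rewrite /psum /lpart /rpart /shuffling all_map -!map_comp.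
  split=> //=.
  - by apply/allP => a ak /=; rewrite addbT; apply: contraNneq k0 => <-.
  - by rewrite (eq_map (g := id)) ?map_id // => a /=; rewrite addn0.
  - by rewrite (eq_map (g := id)) ?map_id ?nz.
  - by elim: (k).
elim: k k0 => [|a k IHk] k0.
  exists [seq (0, a) | a <- x :: u]; rewrite /psum /lpart /rpart /shuffling all_map -!map_comp.
  split.
  - by apply/allP => a ak /=; apply: contraNneq u0 => <-.
  - by rewrite (eq_map (g := id)) ?map_id.
  - by elim: (x :: u).
  - by rewrite (eq_map (g := id)) ?map_id ?nz.
move: (u0) (k0); rewrite !inE !negb_or => /andP[x0 u0'] /andP[a0 k0'].
rewrite /=; case: leqP => ax.
  have [l [cl lE ll rl]] := IHu u0' _ k0.
  exists ((0, x) :: l); split => //=; rewrite ?lE //.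
  - by rewrite eq_sym x0.
  - by rewrite /rpart /= eq_sym x0 -[in RHS]rl.
have [l [cl lE ll rl]] := IHk k0'.
exists ((a, 0) :: l); split=> //=.
- by rewrite eq_sym (negPf a0).
- by rewrite addn0 lE.
- by rewrite /lpart /= eq_sym a0 -[in RHS]ll.
Qed.

(** Shuffles are covered by [shuffling_le]; any other quasi-shuffle adds two letters somewhere, so
    it is shorter and hence smaller. *)
Lemma base_val_psum_le B l : 0 < B -> 0 \notin psum l -> all (gtn B) (psum l) ->
  base_val B (psum l) <= base_val B (merge geq (rpart l) (sort geq (lpart l))).
Proof.
move=> B0 l0 lB.
have [cl|cl] := boolP (shuffling l).
  have geq_total : total geq by move=> x y; rewrite /geq /= leq_total.
  by apply: shuffling_le; rewrite ?sort_sorted // perm_sym perm_sort.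
apply/ltnW/base_val_lt_size => //.
  by rewrite mem_merge mem_cat mem_sort /rpart /lpart !mem_filter eqxx.
by rewrite size_psum size_merge size_cat size_sort addnC size_pairs.
Qed.

Lemma psum_merge_shuffling l k : 0 \notin psum l -> perm_eq (lpart l) k ->
  psum l = merge geq (rpart l) k -> shuffling l.
Proof.
move=> l0 lk E; apply: contraT => /(size_pairs l0).
have := congr1 size E; rewrite size_psum size_merge size_cat addnC -(perm_size lk).
by move=> ->; rewrite ltnn.
Qed.

Local Open Scope ring_scope.

(** * Leading terms of products *)

Lemma exps_cmon_of_iota (w : seq nat) :
  exps (cmon_of (iota 0 (size w)) w) = nonzeros w.
Proof.
rewrite (exps_sub (iota_ltn_sorted 0 (size w))).
  by rewrite map_cmon_of ?iota_uniq ?size_iota.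
by move=> i; apply: cmon_of_supp; rewrite size_iota.
Qed.

(** For [w] without zeros, a quasisymmetric function takes at this monomial the value of its
    coefficient on M_w. Zeros in [w] mark variables absent from a factor. *)
Definition word_monomial (w : seq nat) : {cmonom nat} :=
  cmon_of (iota 0 (size w)) w.

Lemma exps_word w : 0%N \notin w -> exps (word_monomial w) = w.
Proof. exact: exps_cmon_of. Qed.

Lemma pairs_mul (l : seq (nat * nat)) :
  mmul (word_monomial [seq p.1 | p <- l]) (word_monomial [seq p.2 | p <- l]) =
  word_monomial (psum l).
Proof.
apply/eqP/cmP => i; rewrite cmM /word_monomial !cmon_ofE ?size_iota //.
rewrite !size_map; set j := index _ _.
have [jl|lj] := ltnP j (size l); first by rewrite !(nth_map (0, 0)%N).
by rewrite !nth_default ?size_map.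
Qed.

(** The pairs are the exponents of [u] and [v], variable by variable. *)
Lemma word_monomial_factor u v w : 0%N \notin w ->
  mmul u v = word_monomial w ->
  exists l, [/\ psum l = w, u = word_monomial [seq p.1 | p <- l]
                & v = word_monomial [seq p.2 | p <- l]].
Proof.
move=> w0 uvw; set s := iota 0 (size w).
have us : uniq s by exact: iota_uniq.
have inS i : (word_monomial w) i != 0%N -> i \in s.
  by apply: cmon_of_supp; rewrite size_iota.
exists [seq (u i, v i) | i <- s]; rewrite /psum -!map_comp; split.
- rewrite -[RHS](map_cmon_of (s := s)) ?size_iota // -/(word_monomial w) -uvw.
  by apply: eq_map => i /=; rewrite cmM.
- rewrite /word_monomial size_map size_iota -/s cmon_ofK // => i ui; apply: inS.
  by rewrite -uvw cmM addn_eq0 negb_and ui.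
rewrite /word_monomial size_map size_iota -/s cmon_ofK // => i vi; apply: inS.
by rewrite -uvw cmM addn_eq0 negb_and vi orbT.
Qed.

Lemma psM_neq0 (f g : pseries) m : (f * g) m != 0 ->
  exists u v, [/\ mmul u v = m, f u != 0 & g v != 0].
Proof.
move=> fg; apply/not_existsP => H; move/eqP: fg; apply.
rewrite [LHS]/(psmul f g m) /psmul fsbig1 // => -[u v] /= uv; apply/eqP.
rewrite mulf_eq0; apply/negPn/negP; rewrite negb_or => /andP[fu gv].
by case: (H u); exists v.
Qed.

Lemma psM_single (f g : pseries) u v :
    (forall u' v', mmul u' v' = mmul u v -> f u' != 0 -> g v' != 0 ->
       u' = u /\ v' = v) ->
  (f * g) (mmul u v) = f u * g v.
Proof.
move=> H; rewrite [LHS]/(psmul f g _) /psmul.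
rewrite -(@fsbig_widen _ _ _ _ [set (u, v)]%classic) ?fsbig_set1 //.
  by move=> p /= ->.
move=> [u' v'] /= [uv nuv]; apply/eqP; rewrite mulf_eq0.
apply/negPn/negP; rewrite negb_or => /andP[fu gv]; apply: nuv.
by have [-> ->] := H _ _ uv fu gv.
Qed.

Lemma all_ltn_sumn (s : seq nat) N : (sumn s <= N)%N -> all (gtn N.+1) s.
Proof.
move=> sN; apply/allP => x xs; rewrite /= ltnS; apply: leq_trans sN.
by rewrite sumnE (big_rem x) //= leq_addr.
Qed.

(** For [u] in the support of m_k and [v] in that of M_a, the bound is the value of [merge geq a k],
    with [k] sorted. *)
Lemma base_val_factor_le B u v w : 0%N \notin w -> (sumn w < B)%N ->
  mmul u v = word_monomial w ->
  (base_val B w <= base_val B (merge geq (exps v) (sort geq (exps u))))%N.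
Proof.
move=> w0 wB /(word_monomial_factor w0)[l [lw -> ->]].
rewrite /word_monomial !exps_cmon_of_iota -lw.
apply: base_val_psum_le; rewrite ?lw //; first exact: leq_ltn_trans wB.
by case: B wB => // N; apply: all_ltn_sumn.
Qed.

(** This gives the leading coefficient 1: exactly one factorization contributes to m_k M_u at the
    merge, by [shuffling_exists] and [shuffling_uniq]. *)
Lemma merge_factor u k : 0%N \notin u -> 0%N \notin k -> sorted geq k ->
  reduced u ->
  exists v1 v2, [/\ mmul v1 v2 = word_monomial (merge geq u k), exps v1 = k,
    exps v2 = u & forall v1' v2', mmul v1' v2' = word_monomial (merge geq u k) ->
      perm_eq (exps v1') k -> exps v2' = u -> v1' = v1 /\ v2' = v2].
Proof.
move=> u0 k0 sk ru; have [l [cl lE lk lu]] := shuffling_exists u0 k0.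
exists (word_monomial [seq p.1 | p <- l]), (word_monomial [seq p.2 | p <- l]).
rewrite pairs_mul lE /word_monomial !exps_cmon_of_iota; split=> // v1 v2.
have uk0 : 0%N \notin merge geq u k by rewrite mem_merge mem_cat negb_or u0.
move=> /(word_monomial_factor uk0)[l' [lE' -> ->]].
rewrite /word_monomial !exps_cmon_of_iota => lk' lu'.
have cl' : shuffling l'.
  by apply: (@psum_merge_shuffling _ k); rewrite // ?lE' // /rpart lu'.
have km : path geq (head 0%N k) k by case: (k) sk => //= a s ->; rewrite leqnn.
rewrite (@shuffling_uniq _ u k l l' km (reduced_belowW _ ru)) //.
by rewrite lk.
Qed.

Lemma monomial_qsym_in a : 0%N \notin a -> monomial_qsym a \in qsym_pred.
Proof.
move=> a0; apply/qsym_predP; split; last first.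
  by move=> m m' mm'; rewrite !monomial_qsymE // mm'.
exists (sumn a) => m; rewrite monomial_qsymE // mdeg_exps.
by case: eqP => // ->; rewrite ltnn.
Qed.

Lemma monomial_sym_in a : 0%N \notin a -> monomial_sym a \in sym_pred.
Proof.
move=> a0; apply/sym_predP; split; last first.
  move=> m m' mm'; rewrite !monomial_symE //; congr (nat_of_bool _)%:R.
  apply/idP/idP; last exact: perm_trans.
  by apply: perm_trans; rewrite perm_sym.
exists (sumn a) => m; rewrite monomial_symE // mdeg_exps.
have [p|//] := boolP (perm_eq _ _).
by rewrite !sumnE (perm_big _ p) ltnn.
Qed.

Lemma sym_coef_sort f m : f \in sym_pred ->
  f m = f (word_monomial (sort geq (exps m))).
Proof.
case/sym_predP => _; apply; rewrite exps_word ?mem_sort ?exps_neq0 //.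
by rewrite perm_sym perm_sort.
Qed.

Lemma qsym_coef f m : f \in qsym_pred -> f m = f (word_monomial (exps m)).
Proof. by case/qsym_predP => _; apply; rewrite exps_word ?exps_neq0. Qed.

(** * The basis *)

Definition reduced_word : choiceType := {u : seq nat | (0%N \notin u) && reduced u}.

Lemma reduced_word_neq0 (u : reduced_word) : 0%N \notin val u.
Proof. by case/andP: (valP u). Qed.

Lemma reduced_wordP (u : reduced_word) : reduced (val u).
Proof. by case/andP: (valP u). Qed.

Definition reduced_qsym (u : reduced_word) : QSym :=
  MkQSym (monomial_qsym_in (reduced_word_neq0 u)).

Lemma lincombE (R : nzRingType) (V : lmodType R) (I : choiceType) (b : I -> V)
    (c : {fsfun I -> R with 0}) (A : {fset I}) : (finsupp c `<=` A)%fset ->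
  lincomb b c = \sum_(i <- A) c i *: b i.
Proof.
move=> cA; apply: big_fset_incl => // i _ ic.
by rewrite fsfun_dflt // scale0r.
Qed.

Lemma lincomb_add1 (R : nzRingType) (V : lmodType R) (I : choiceType)
    (b : I -> V) (c : {fsfun I -> R with 0}) (i : I) (r : R) :
  exists c' : {fsfun I -> R with 0}, lincomb b c' = lincomb b c + r *: b i.
Proof.
exists [fsfun c with i |-> c i + r].
rewrite (@lincombE _ _ _ _ c (i |` finsupp c)%fset) ?fsubsetUr //.
rewrite (@lincombE _ _ _ _ _ (i |` finsupp c)%fset); last first.
  by apply/fsubsetP => j; rewrite in_fset1U !mem_finsupp fsfun_withE; have [] := eqVneq j i.
rewrite (big_fsetD1 i) ?fset1U1 //= [in RHS](big_fsetD1 i) ?fset1U1 //= fsfun_with scalerDl addrAC.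
congr (_ + _ + _); apply: eq_big_seq => j; rewrite !inE => /andP[/negPf ji _].
by rewrite fsfun_withE ji.
Qed.

Lemma sorted_geq_sort (s : seq nat) : sorted geq (sort geq s).
Proof. by apply: sort_sorted => x y; rewrite /geq /= leq_total. Qed.

Lemma exps_sumnM u v : sumn (exps (mmul u v)) = (sumn (exps u) + sumn (exps v))%N.
Proof. by rewrite -!mdeg_exps mdegM. Qed.

Lemma sumn_merge u k : sumn (merge geq u k) = (sumn u + sumn k)%N.
Proof.
rewrite -sumn_cat !sumnE; apply: perm_big.
by rewrite perm_merge.
Qed.

Lemma size_le_sumn s : 0%N \notin s -> (size s <= sumn s)%N.
Proof.
elim: s => //= x s IH; rewrite inE negb_or eq_sym -lt0n => /andP[x0 /IH].
by rewrite -add1n; apply: leq_add.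
Qed.

Lemma path_geq_head m k : sorted geq k -> (head 0 k <= m)%N -> path geq m k.
Proof. by case: k => //= a k -> ->. Qed.

Lemma sort_geq_perm s k : perm_eq s k -> sorted geq k -> sort geq s = k.
Proof.
move=> sk kk; apply: (sorted_eq geq_trans _ (sorted_geq_sort s) kk).
  by move=> x y /=; rewrite andbC -eqn_leq => /eqP.
by rewrite perm_sort.
Qed.

Lemma reduced_merge_inj (u u' : reduced_word) k k' :
  sorted geq k -> sorted geq k' ->
  merge geq (val u) k = merge geq (val u') k' -> u = u' /\ k = k'.
Proof.
move=> sk sk' E.
have km := path_geq_head sk (leq_addr (head 0 k') (head 0 k)).
have km' := path_geq_head sk' (leq_addl (head 0 k) (head 0 k')).
have [uu' ->] := merge_inj km km' (reduced_belowW _ (reduced_wordP u))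
  (reduced_belowW _ (reduced_wordP u')) E.
by split=> //; apply: val_inj.
Qed.

Lemma composition_merge w : 0%N \notin w -> exists (u : reduced_word) k,
  [/\ sorted geq k, 0%N \notin k & w = merge geq (val u) k].
Proof.
move=> w0; have [u [k [wE km um]]] := merge_decomp (sumn w) w.
move: w0; rewrite {1}wE mem_merge mem_cat negb_or => /andP[u0 k0].
have ru : reduced u.
  apply: reduced_belowT um; apply/allP => x xu /=.
  have xw : x \in w by rewrite wE mem_merge mem_cat xu.
  by rewrite sumnE (big_rem x) //= leq_addr.
have P : (0%N \notin u) && reduced u by rewrite u0.
by exists (exist _ u P), k; split=> //; exact: path_sorted km.
Qed.

(** * Spanning *)

(** Base [N.+1] exceeds every letter, so at most one word of [f] has the top value. Writing it as
    [merge geq u k] and subtracting the right multiple of m_k M_u removes it and brings in smaller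
    words only. *)
Lemma reduced_qsym_span_below N n (f : QSym) :
    (forall w : seq nat, 0%N \notin w -> val f (word_monomial w) != 0 ->
       (sumn w <= N)%N && (base_val N.+1 w < n)%N) ->
  exists c : {fsfun reduced_word -> Sym with 0}, f = lincomb reduced_qsym c.
Proof.
elim: n f => [|n IH] f fP.
  exists [fsfun]; rewrite /lincomb finsupp0 big_seq_fset0.
  apply: val_inj; apply/funext => m.
  apply: etrans (qsym_coef m (qsym_valP f)) _; apply/eqP/contraT => /fP.
  by rewrite exps_neq0 andbF => /(_ isT).
have [[w [w0 fw wn]]|H] := pselect (exists w : seq nat,
    [/\ 0%N \notin w, val f (word_monomial w) != 0 & base_val N.+1 w = n]); last first.
  apply: IH => w w0 fw; have /andP[-> /=] := fP _ w0 fw.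
  rewrite ltnS leq_eqVlt => /orP[/eqP wn|//].
  by case: H; exists w.
have /andP[wN _] := fP _ w0 fw.
have [u [k [sk k0 wE]]] := composition_merge w0.
pose z := val f (word_monomial w).
pose s : Sym := MkSym (monomial_sym_in k0).
pose g := s *: reduced_qsym u.
have gE m : val g m = (monomial_sym k * monomial_qsym (val u)) m by [].
have gsupp v1 v2 : monomial_sym k v1 != 0 -> monomial_qsym (val u) v2 != 0 ->
    perm_eq (exps v1) k /\ exps v2 = val u.
  rewrite monomial_symE // monomial_qsymE ?reduced_word_neq0 //.
  by case: (perm_eq _ _) => //; case: (exps v2 =P _).
have gw : val g (word_monomial w) = 1.
  rewrite gE wE.
  have [v1 [v2 [<- v1k v2u uniq]]] :=
    merge_factor (reduced_word_neq0 u) k0 sk (reduced_wordP u).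
  rewrite psM_single => [|v1' v2' E /gsupp/[apply] -[]]; last exact: uniq.
  by rewrite monomial_symE // v1k perm_refl monomial_qsymE ?reduced_word_neq0 // v2u eqxx.
(* The product is homogeneous of degree [sumn w], so the bound [N] and the base survive the
   subtraction. *)
have gP w' : 0%N \notin w' -> val g (word_monomial w') != 0 ->
    (sumn w' <= N)%N && (base_val N.+1 w' <= n)%N.
  move=> w'0; rewrite gE => /psM_neq0[v1 [v2 [E /gsupp/[apply] -[v1k v2u]]]].
  have sw : sumn w' = sumn w.
    rewrite wE sumn_merge -(exps_word w'0) -E exps_sumnM v2u addnC.
    by rewrite -(perm_sumn v1k).
  rewrite sw wN -wn wE -v2u -(sort_geq_perm v1k sk).
  by apply: base_val_factor_le; rewrite ?sw.
have dE m : val (f - g *~ z) m = val f m - val g m *~ z.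
  by rewrite raddfB raddfMz psD psN psMz.
have [|c cE] := IH (f - g *~ z).
  move=> w' w'0; rewrite dE => nz.
  have : (sumn w' <= N)%N && (base_val N.+1 w' <= n)%N.
    have [gw'|/(gP _ w'0)//] := eqVneq (val g (word_monomial w')) 0.
    by apply: fP; move: nz; rewrite gw' mul0rz subr0.
  case/andP=> w'N; rewrite w'N leq_eqVlt => /orP[/eqP w'n|//].
  have ww' : w' = w.
    by apply: (@base_val_inj N.+1); rewrite ?all_ltn_sumn ?w'n.
  by move: nz; rewrite ww' gw intz subrr eqxx.
have [c' c'E] := lincomb_add1 reduced_qsym c u (s *~ z).
by exists c'; rewrite c'E -cE scalerMzl subrK.
Qed.

Lemma reduced_qsym_span (f : QSym) :
  exists c : {fsfun reduced_word -> Sym with 0}, f = lincomb reduced_qsym c.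
Proof.
have [[N fN] _] := (qsym_predP _).1 (qsym_valP f).
(* A composition of sum at most [N] has at most [N] letters, which bounds its value by this
   power. *)
apply: (@reduced_qsym_span_below N (N.+1 ^ N)%N) => w w0 fw.
have wN : (sumn w <= N)%N.
  rewrite leqNgt; apply: contra fw => lt; apply/eqP/fN.
  by rewrite mdeg_exps exps_word.
rewrite wN; apply: leq_trans (base_val_lt (all_ltn_sumn wN)) _.
by rewrite leq_pexp2l // (leq_trans (size_le_sumn w0)).
Qed.

(** * Linear independence *)

Lemma sym_bound (c : reduced_word -> Sym) (s : seq reduced_word) :
  exists N, forall i, i \in s ->
    (sumn (val i) <= N)%N /\ forall m, (N < mdeg m)%N -> val (c i) m = 0.
Proof.
elim: s => [|i s [N IH]]; first by exists 0%N.
have [[n cn] _] := (sym_predP _).1 (sym_valP (c i)).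
exists (n + sumn (val i) + N)%N => j; rewrite inE => /orP[/eqP->|/IH[jN cN]].
  split; first by rewrite -addnA addnCA leq_addr.
  by move=> m lt; apply: cn; apply: leq_ltn_trans lt; rewrite -addnA leq_addr.
split; first by rewrite (leq_trans jN) // leq_addl.
by move=> m lt; apply: cN; apply: leq_ltn_trans lt; rewrite leq_addl.
Qed.

(** Among all pairs of an index [i] and a partition [k] with m_k occurring in [c i], take one with
    the largest merge. Nothing else contributes to the combination at that word, so its coefficient
    there is that of m_k in [c i], which is not zero. *)
Lemma reduced_qsym_free (c : {fsfun reduced_word -> Sym with 0}) :
  lincomb reduced_qsym c = 0 -> forall i, c i = 0.
Proof.
move=> c0 i0; apply/eqP/contraT => ci0.
have [N cN] := sym_bound c (finsupp c).
(* One [N] bounds the sum of the index, the other the degree of its coefficient, so every merge has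
   letters below [B]. *)
pose B := (N + N).+1.
pose P n := `[< exists i (k : seq nat), [/\ 0%N \notin k, sorted geq k,
  val (c i) (word_monomial k) != 0 & n = base_val B (merge geq (val i) k)] >].
have PI i m : val (c i) m != 0 ->
    P (base_val B (merge geq (val i) (sort geq (exps m)))).
  move=> cm; apply/asboolP; exists i, (sort geq (exps m)).
  rewrite mem_sort exps_neq0 sorted_geq_sort -sym_coef_sort //.
  exact: sym_valP.
have cB i m : val (c i) m != 0 ->
    (sumn (merge geq (val i) (sort geq (exps m))) < B)%N.
  move=> cm; have ic : i \in finsupp c.
    by rewrite mem_finsupp; apply: contraNneq cm => ->.
  have [iN mN] := cN _ ic; rewrite sumn_merge ltnS leq_add //.
  rewrite (perm_sumn (_ : perm_eq _ (exps m))) ?perm_sort // -mdeg_exps leqNgt.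
  by apply: contra cm => /mN ->.
have exP : exists n, P n.
  suff [m cm] : exists m, val (c i0) m != 0 by eexists; exact: PI cm.
  apply/not_existsP => H; move/eqP: ci0; apply; apply: val_inj.
  by apply/funext => m; apply/eqP/contraT => /H.
have ubP n : P n -> (n <= B ^ B)%N.
  case/asboolP => i [k [k0 sk ck ->]].
  have := cB _ _ ck; rewrite exps_word // (sort_geq_perm _ sk) // => lt.
  apply/ltnW/(leq_trans (base_val_lt (all_ltn_sumn lt))).
  rewrite leq_pexp2l //; apply: leq_trans (ltnW lt); apply: size_le_sumn.
  by rewrite mem_merge mem_cat negb_or reduced_word_neq0.
have [n /asboolP[i [k [k0 sk ck nE]]] nmax] := ex_maxnP exP ubP.
(* The merge of a contributing pair is at least the word by [base_val_factor_le] and at most it by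
   maximality, so [reduced_merge_inj] identifies the pair. *)
have lead j v1 v2 : mmul v1 v2 = word_monomial (merge geq (val i) k) ->
    val (c j) v1 != 0 -> exps v2 = val j -> i = j /\ perm_eq (exps v1) k.
  move=> E cv v2j.
  have ik0 : 0%N \notin merge geq (val i) k.
    by rewrite mem_merge mem_cat negb_or reduced_word_neq0.
  have ikB : (sumn (merge geq (val i) k) < B)%N.
    by have := cB _ _ ck; rewrite exps_word // (sort_geq_perm _ sk).
  have := base_val_factor_le ik0 ikB E; rewrite v2j -nE => le.
  have ge := nmax _ (PI _ _ cv).
  have eq_merge : merge geq (val i) k = merge geq (val j) (sort geq (exps v1)).
    apply: (@base_val_inj B) => //; first exact: all_ltn_sumn.
    - by apply: all_ltn_sumn; exact: cB cv.
    - by rewrite mem_merge mem_cat negb_or reduced_word_neq0 mem_sort exps_neq0.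
    by apply/eqP; rewrite -nE eqn_leq le ge.
  have [-> ->] := reduced_merge_inj sk (sorted_geq_sort _) eq_merge.
  by rewrite perm_sym perm_sort.
have ic : i \in finsupp c.
  by rewrite mem_finsupp; apply: contraNneq ck => ->.
have qE (j : reduced_word) v : monomial_qsym (val j) v != 0 -> exps v = val j.
  by rewrite monomial_qsymE ?reduced_word_neq0 //; case: (exps v =P val j).
have : \sum_(j <- finsupp c) (val (c j) * monomial_qsym (val j))
    (word_monomial (merge geq (val i) k)) = 0.
  have := congr1 (fun f : QSym => val f (word_monomial (merge geq (val i) k))) c0.
  by rewrite /lincomb raddf_sum pssum.
rewrite (big_fsetD1 i) //= big1_seq ?addr0; last first.
  move=> j /andP[_]; rewrite !inE => /andP[ji _]; apply/eqP/contraT.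
  move=> /psM_neq0[v1 [v2 [E cv /qE v2j]]].
  by have [ij _] := lead _ _ _ E cv v2j; rewrite ij eqxx in ji.
have [v1 [v2 [E v1k v2u uniq]]] :=
  merge_factor (reduced_word_neq0 i) k0 sk (reduced_wordP i).
rewrite -E psM_single => [|v1' v2' E' cv /qE v2j]; last first.
  rewrite E in E'; have [_ pk] := lead _ _ _ E' cv v2j; exact: uniq.
rewrite monomial_qsymE ?reduced_word_neq0 // v2u eqxx mulr1.
rewrite (sym_coef_sort _ (sym_valP _)) v1k (sort_geq_perm _ sk) // => /eqP ck0.
by case/negP: ck.
Qed.

Theorem proposition9p2 : free_module Sym QSym.
Proof.
exists reduced_word, reduced_qsym; split.
  exact: reduced_qsym_span.
exact: reduced_qsym_free.
Qed.
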